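(* Let $(\Omega,\mathcal A)$ be a measurable space and let $K$ be a random compact set in $\mathbb C^n$. Then its rationally convex hull, defined by $\omega\mapsto\mathcal R\text{-hull}\,(K(\omega))$, is a random compact set.
   Context: A random compact set is a measurable map from $\Omega$ to the space $\mathcal K'(\mathbb C^n)$ of non-empty compact subsets of $\mathbb C^n$ with the Hausdorff distance and its Borel $\sigma$-algebra. For compact $L$, $\mathcal R\text{-hull}\,L=\{z\in\mathbb C^n:|r(z)|\le\max_{x\in L}|r(x)| \text{ for all rational functions } r \text{ on } \mathbb C^n \text{ analytic (without singularities) on } L\}$. *)

(* Defs.v *)
From HB Require Import structures.
From mathcomp Require Import all_boot all_order all_algebra.
From mathcomp Require Import all_classical all_reals all_analysis.
From mathcomp Require Import complex.
From mathcomp Require mpoly.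
Import numFieldTopology.Exports numFieldNormedType.Exports.

Set Implicit Arguments.
Unset Strict Implicit.
Unset Printing Implicit Defensive.

Import Order.TTheory GRing.Theory Num.Theory.
Local Open Scope classical_set_scope.
Local Open Scope ring_scope.

(* The complex numbers C = R[i] over a realType R, viewed (via ^o) as a
   normed space over themselves so that they carry the usual metric topology.
   C^n is the row-vector space 'rV[C]_n with its (product) topology, which is
   the usual topology of C^n. *)
Notation Cn R n := 'rV[(R[i])^o]_n.

Definition cabs (R : realType) (z : R[i]) : R := ComplexField.Normc.normc z.

Definition cdist (R : realType) (n : nat) (z w : Cn R n) : R :=
  Num.sqrt (\sum_(i < n) cabs (z ord0 i - w ord0 i) ^+ 2).

Definition ncompact (R : realType) (n : nat) :=
  {K : set (Cn R n) | K !=set0 /\ compact K}.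

Definition pt_set_dist (R : realType) (n : nat) (z : Cn R n) (B : set (Cn R n)) : R :=
  inf [set cdist z b | b in B].

Definition hausdorff_dist (R : realType) (n : nat) (A B : set (Cn R n)) : R :=
  Num.max (sup [set pt_set_dist a B | a in A]) (sup [set pt_set_dist b A | b in B]).

Definition hausdorff_open (R : realType) (n : nat) (U : set (ncompact R n)) : Prop :=
  forall K, U K -> exists2 e : R, 0 < e &
    forall L : ncompact R n, hausdorff_dist (sval K) (sval L) < e -> U L.

Definition hausdorff_borel (R : realType) (n : nat) : set (set (ncompact R n)) :=
  <<s [set U | @hausdorff_open R n U] >>.

Definition random_compact_set (R : realType) (n : nat) (d : measure_display)
    (Omega : measurableType d) (K : Omega -> ncompact R n) : Prop :=
  forall B, hausdorff_borel B -> measurable (K @^-1` B).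

Definition peval (R : realType) (n : nat) (p : mpoly.mpoly n R[i]) (z : Cn R n) : R[i] :=
  mpoly.meval (fun i => z ord0 i) p.

(* R-hull L: rational functions analytic on L are the p/q with p, q
   polynomials and q without zeros on L. *)
Definition rational_hull (R : realType) (n : nat) (L : set (Cn R n)) : set (Cn R n) :=
  [set z | forall p q : mpoly.mpoly n R[i],
     (forall x, L x -> peval q x != 0) ->
     peval q z != 0 /\
     cabs (peval p z / peval q z) <= sup [set cabs (peval p x / peval q x) | x in L]].

(* Main.v *)
(* A point z lies in the rationally convex hull of L iff every polynomial takes
   at some point of L the value that it takes at z: apply the definition to
   1 / (p - p(z)) in one direction, and look at p - c q with c = (p / q)(z) in
   the other. If p(z) is not in p(L), this persists under small perturbations
   of z and of L, so by compactness {L | hull L misses G} is open in the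
   Hausdorff distance for every closed G. Open sets are countable unions of
   closed ones, so "hull L hits O" is a Borel condition for O open. Finally,
   K'(C^n) is separable: each of its open sets is a countable union of sets
   of the form {L | L is covered by finitely many given balls with rational
   centres and equal radius, and hits each of them}. *)
Require Import Defs.
From HB Require Import structures.
From mathcomp Require Import all_boot all_order all_algebra.
From mathcomp Require Import all_classical all_reals all_analysis.
From mathcomp Require Import complex.
From mathcomp Require Import lra.
From mathcomp Require mpoly.
Import (canonicals) mpoly.
Import numFieldTopology.Exports numFieldNormedType.Exports.
Local Open Scope classical_set_scope.
Local Open Scope ring_scope.

Set Implicit Arguments.
Unset Strict Implicit.
Unset Printing Implicit Defensive.

Import Order.TTheory GRing.Theory Num.Theory.
Local Open Scope complex_scope.

(** * Metric and continuity in C^n *)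

Lemma nbhs_ballC (R : realType) (V : pseudoMetricType R[i]) (z : V) (A : set V) :
  nbhs z A <-> exists2 e : R, 0 < e & ball z e%:C `<=` A.
Proof.
split=> [/nbhs_ballP [[e f] /=]|[e e0 eA]].
  (* In the order of R[i] a positive element has imaginary part 0, so every radius is real. *)
  by rewrite ltcE /= => /andP [/eqP -> e0] eA; exists e.
by apply/nbhs_ballP; exists e%:C => //=; rewrite ltcR.
Qed.

Lemma ball_coordP (R : realType) (n : nat) (z w : Cn R n) (e : R) : 0 < e ->
  ball z e%:C w <-> forall i, cabs (z ord0 i - w ord0 i) < e.
Proof.
move=> e0; have cabsE (x y : (R[i])^o) : ball x e%:C y = (cabs (x - y) < e) :> Prop.
  by rewrite -ltcR.
split=> [[_ zw] i|zw]; first by rewrite -cabsE; exact: zw.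
split=> [|i j]; first by rewrite ltcR.
by rewrite cabsE ord1.
Qed.

Lemma cdist_ge0 (R : realType) (n : nat) (z w : Cn R n) : 0 <= cdist z w.
Proof. exact: sqrtr_ge0. Qed.

Lemma cabs_ge0 (R : realType) (x : R[i]) : 0 <= cabs x.
Proof. by case: x => a b; exact: sqrtr_ge0. Qed.

Lemma coord_le_cdist (R : realType) (n : nat) (z w : Cn R n) i :
  cabs (z ord0 i - w ord0 i) <= cdist z w.
Proof.
rewrite -(ger0_norm (cabs_ge0 _)) -sqrtr_sqr; apply: ler_wsqrtr.
by rewrite (bigD1 i) //= lerDl; apply: sumr_ge0 => j _; exact: sqr_ge0.
Qed.

Lemma cdist_ball (R : realType) (n : nat) (z w : Cn R n) (e : R) : 0 < e ->
  cdist z w < e -> ball z e%:C w.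
Proof.
move=> e0 zw; apply/ball_coordP => // i.
exact: le_lt_trans (coord_le_cdist _ _ i) zw.
Qed.

(** Balls of the row-vector space are polydiscs while [cdist] is Euclidean, hence the factor sqrt n.
    The bound is not strict since both sides vanish for n = 0. *)
Lemma ball_cdist (R : realType) (n : nat) (z w : Cn R n) (e : R) : 0 < e ->
  ball z e%:C w -> cdist z w <= Num.sqrt n%:R * e.
Proof.
move=> e0 /ball_coordP zw.
rewrite -[leRHS]ger0_norm ?mulr_ge0 ?sqrtr_ge0 ?(ltW e0)// -sqrtr_sqr.
apply: ler_wsqrtr; rewrite exprMn sqr_sqrtr ?ler0n//.
rewrite mulr_natl -[X in _ *+ X]card_ord -sumr_const; apply: ler_sum => i _.
by rewrite ler_sqr ?nnegrE ?cabs_ge0 ?(ltW e0) // ltW // zw.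
Qed.

Lemma meval_continuous (K : numFieldType) (n : nat) (p : mpoly.mpoly n K) :
  continuous (fun z : 'rV[K]_n => mpoly.meval (fun i => z ord0 i) p).
Proof.
move=> z; have Fz : Filter (nbhs z) by exact: nbhs_filter.
rewrite /continuous_at.
under eq_fun do rewrite mpoly.mevalE.
rewrite mpoly.mevalE.
apply: cvg_big => [|m _]; first exact: add_continuous.
apply: cvgM; first exact: cvg_cst.
apply: cvg_big => [|i _]; first exact: mul_continuous.
elim: (mpoly.fun_of_multinom m i) => [|k IH].
  by under eq_fun do rewrite expr0; exact: cvg_cst.
under eq_fun do rewrite exprS.
rewrite exprS; apply: cvgM => //; exact: coord_continuous.
Qed.

Lemma meval_div_continuous (K : numFieldType) (n : nat) (p q : mpoly.mpoly n K)
    (z : 'rV[K]_n) : mpoly.meval (fun i => z ord0 i) q != 0 ->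
  {for z, continuous (fun z : 'rV[K]_n =>
     mpoly.meval (fun i => z ord0 i) p / mpoly.meval (fun i => z ord0 i) q)}.
Proof.
move=> qz; have Fz : Filter (nbhs z) by exact: nbhs_filter.
apply: cvgM; first exact: meval_continuous.
by apply: cvgV; [exact: qz|exact: meval_continuous].
Qed.

Lemma peval_continuous (R : realType) (n : nat) (p : mpoly.mpoly n R[i]) :
  continuous (peval p : Cn R n -> (R[i])^o).
Proof. exact: (@meval_continuous R[i] n p). Qed.

Lemma normE_cabs (R : realType) (x : R[i]) : `|x| = (cabs x)%:C.
Proof. by []. Qed.

Lemma cabsD (R : realType) (x y : R[i]) : cabs (x + y) <= cabs x + cabs y.
Proof. by rewrite -lecR rmorphD /= -!normE_cabs; exact: ler_normD. Qed.

Lemma cabs_distC (R : realType) (x y : R[i]) : cabs (x - y) = cabs (y - x).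
Proof. by apply: (@complexI R); rewrite -!normE_cabs distrC. Qed.

Lemma cabs_distD (R : realType) (y x z : R[i]) :
  cabs (x - z) <= cabs (x - y) + cabs (y - z).
Proof. by rewrite -[x - z](subrKA y); exact: cabsD. Qed.

Lemma cabs_eq0 (R : realType) (x : R[i]) : cabs x = 0 -> x = 0.
Proof. exact: ComplexField.Normc.eq0_normc. Qed.

Lemma ball_cabs (R : realType) (x y : (R[i])^o) (e : R) :
  ball x e%:C y <-> cabs (x - y) < e.
Proof. by rewrite -ltcR. Qed.

Lemma continuous_ballC (R : realType) (T : topologicalType)
    (V : pseudoMetricType R[i]) (f : T -> V) (x : T) (e : R) :
  0 < e -> {for x, continuous f} -> \forall y \near x, ball (f x) e%:C (f y).
Proof.
by move=> e0 fc; apply: (fc (ball (f x) e%:C)); apply/nbhs_ballC; exists e.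
Qed.

Lemma continuous_cabs (R : realType) (T : topologicalType)
    (f : T -> (R[i])^o) (x : T) (e : R) :
  0 < e -> {for x, continuous f} -> \forall y \near x, cabs (f x - f y) < e.
Proof.
move=> e0 fc; apply: filterS (continuous_ballC e0 fc) => y.
by move/ball_cabs.
Qed.

(** * Compactness and boundedness in C^n *)

Lemma compact_cabs_bounded (R : realType) (T : topologicalType) (L : set T)
    (f : T -> (R[i])^o) :
  compact L -> (forall x, L x -> {for x, continuous f}) ->
  exists M, forall x, L x -> cabs (f x) <= M.
Proof.
move=> /compact_near_coveringP cL fc.
(* Near x, every M >= |f(x)| + 1 is a bound; the near-covering form of compactness makes one M work
   on all of L. *)
suff : \forall M \near +oo, L `<=` [set x | cabs (f x) <= M].
  by move=> /filter_ex [M LM]; exists M.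
apply: cL => x Lx.
exists ([set y | cabs (f x - f y) < 1], [set M | cabs (f x) + 1 <= M]) => /=.
  split; last by apply: nbhs_pinfty_ge; exact: num_real.
  exact: continuous_cabs ltr01 (fc x Lx).
move=> [y M] /= [fxy xM].
apply: le_trans xM; rewrite -[f y](subrKC (f x)).
apply: le_trans (cabsD _ _) _; rewrite lerD2l.
by rewrite cabs_distC ltW.
Qed.

Lemma cabs_lt_half (R : realType) (x y e : R) :
  `|x| < e / 2 -> `|y| < e / 2 -> cabs (x +i* y) < e.
Proof.
move=> xe ye; have e0 : 0 < e by have := le_lt_trans (normr_ge0 x) xe; lra.
rewrite /cabs /= -[ltRHS]ger0_norm ?ltW// -sqrtr_sqr ltr_sqrt ?exprn_gt0//.
have h (t : R) : `|t| < e / 2 -> t ^+ 2 < e ^+ 2 / 4.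
  rewrite -real_normK ?num_real// => te.
  have -> : e ^+ 2 / 4 = (e / 2) ^+ 2 by rewrite expr_div_n -natrX.
  by rewrite ltr_pXn2r // nnegrE ltW // divr_gt0.
apply: lt_le_trans (ltrD (h _ xe) (h _ ye)) _.
have := sqr_ge0 e; lra.
Qed.

(** Squares are used rather than discs because they are continuous images of a product of two
    segments, so compactness comes from that of segments. *)
Definition square (R : realType) (M : R) : set (R[i])^o :=
  [set x | `|complex.Re x| <= M /\ `|complex.Im x| <= M].

Lemma square_compact (R : realType) (M : R) : compact (square M).
Proof.
pose f (u : R * R) : (R[i])^o := u.1 +i* u.2.
have -> : square M = f @` (`[- M, M]%classic `*` `[- M, M]%classic).
  apply/seteqP; split=> [[a b]|_ [[a b] /= + <-]].
    by rewrite /square /= !ler_norml => -[aM bM]; exists (a, b); rewrite //= !in_itv.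
  by rewrite !in_itv /= -!ler_norml.
apply: continuous_compact; last by apply: compact_setX; exact: segment_compact.
apply: continuous_subspaceT => -[a b] A /nbhs_ballC [e e0 eA].
apply/nbhs_ballP; exists (e / 2); first by rewrite /= divr_gt0.
move=> [c d] [/= ac bd]; apply: eA; apply/ball_cabs => /=.
exact: cabs_lt_half ac bd.
Qed.

Lemma near_right_ex (R : realType) (B : set R) :
  (\forall e \near (0 : R)^'+, B e) -> exists2 e : R, 0 < e & B e.
Proof.
move=> B0; have /filter_ex [e [e0 Be]] : \forall e \near (0 : R)^'+, 0 < e /\ B e.
  by apply: filterI => //; exact: nbhs_right_gt.
by exists e.
Qed.

Lemma square_cabs (R : realType) (M : R) (x : R[i]) : cabs x <= M -> square M x.
Proof.
case: x => a b; rewrite /cabs /= => abM.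
by split=> /=; apply: le_trans abM; rewrite -sqrtr_sqr ler_wsqrtr //
  ?lerDl ?lerDr sqr_ge0.
Qed.

Definition polybox (R : realType) (n : nat) (M : R) : set (Cn R n) :=
  [set z | forall i, square M (z ord0 i)].

Lemma polybox_compact (R : realType) (n : nat) (M : R) : compact (@polybox R n M).
Proof.
exact: (@rV_compact (R[i])^o n (fun=> square M) (fun=> @square_compact R M)).
Qed.

Lemma compact_coord_bounded (R : realType) (n : nat) (L : set (Cn R n)) :
  compact L -> exists M, forall x, L x -> forall i, cabs (x ord0 i) <= M.
Proof.
move=> cL.
have /choice [M LM] : forall i, exists M, forall x : Cn R n,
    L x -> cabs (x ord0 i) <= M.
  move=> i; apply: (@compact_cabs_bounded R _ L (fun z => z ord0 i)) => // x _.
  exact: (@coord_continuous R[i] 1 n ord0 i x).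
exists (\sum_i `|M i|) => x Lx i; apply: le_trans (LM i x Lx) _.
rewrite (bigD1 i) //=; apply: le_trans (ler_norm _) _.
by rewrite lerDl; apply: sumr_ge0 => j _; exact: normr_ge0.
Qed.

(** * The rational hull through values of polynomials *)

Definition poly_hull (R : realType) (n : nat) (L : set (Cn R n)) : set (Cn R n) :=
  [set z | forall p : mpoly.mpoly n R[i], exists2 x, L x & peval p x = peval p z].

Lemma pevalBC (R : realType) (n : nat) (p q : mpoly.mpoly n R[i]) c (z : Cn R n) :
  peval (p - mpoly.mpolyC n c * q)%R z = peval p z - c * peval q z.
Proof. by rewrite /peval mpoly.mevalB mpoly.mevalM mpoly.mevalC. Qed.

Lemma rational_hullE (R : realType) (n : nat) (L : set (Cn R n)) :
  compact L -> rational_hull L = poly_hull L.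
Proof.
move=> cL; apply/seteqP; split=> z hz.
  move=> p; apply: contrapT => npz.
  (* The numerator is 0: the contradiction comes from the clause of [rational_hull] by which the
     denominator p - p(z) cannot vanish at z. *)
  have [] := hz 0%R (p - mpoly.mpolyC n (peval p z) * mpoly.mpolyC n 1).
    move=> x Lx; rewrite pevalBC /peval mpoly.mevalC mulr1 subr_eq0.
    by apply/eqP => pxz; apply: npz; exists x.
  by rewrite pevalBC /peval mpoly.mevalC mulr1 subrr eqxx.
move=> p q q0.
have qz : peval q z != 0.
  by have [x Lx <-] := hz q; exact: q0.
split=> //.
(* With c = (p / q)(z), the polynomial p - c q vanishes at z, hence at some x in L, where p / q
   takes the value c. *)
have [x Lx] := hz (p - mpoly.mpolyC n (peval p z / peval q z) * q).
rewrite !pevalBC (divfK qz) subrr => /subr0_eq pxE.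
have pqE : peval p x / peval q x = peval p z / peval q z.
  rewrite pxE mulfK; [by []|exact: q0].
(* A value is below the [sup] only if the values are bounded above; this is where compactness of L
   enters. *)
apply: ub_le_sup; last by exists x; [exact: Lx|rewrite pqE].
have [y Ly|M LM] := @compact_cabs_bounded R _ L (fun x => peval p x / peval q x) cL.
  exact: (@meval_div_continuous R[i] n p q y (q0 y Ly)).
by exists M => _ [y Ly <-]; exact: LM.
Qed.

(** * Compactness and upper semicontinuity of the hull *)

Definition thickening (R : realType) (n : nat) (e : R) (L : set (Cn R n)) :=
  [set x | exists2 y, L y & ball y e%:C x].

Lemma sub_thickening (R : realType) (n : nat) (e : R) (L : set (Cn R n)) :
  0 < e -> L `<=` thickening e L.
Proof. by move=> e0 x Lx; exists x => //; apply: ballxx; rewrite ltcR. Qed.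

Lemma sub_poly_hull (R : realType) (n : nat) (L : set (Cn R n)) : L `<=` poly_hull L.
Proof. by move=> z Lz p; exists z. Qed.

(** Coordinates are polynomials, so each coordinate of a hull point is attained on L'. This confines
    the hulls of all sets near L to one compact set. *)
Lemma poly_hull_polybox (R : realType) (n : nat) (L L' : set (Cn R n)) (M : R) :
  (forall x, L x -> forall i, cabs (x ord0 i) <= M) -> L' `<=` thickening 1 L ->
  poly_hull L' `<=` polybox (M + 1).
Proof.
move=> LM LL' z hz i; apply: square_cabs.
have [x /LL' [y Ly /(ball_coordP _ _ ltr01) yx]] :=
  hz (mpoly.mpolyX _ (mpoly.mnm1 i)).
rewrite /peval !mpoly.mevalXU => <-.
rewrite -[x ord0 i](subrKC (y ord0 i)); apply: le_trans (cabsD _ _) _.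
apply: lerD (LM y Ly i) _; rewrite cabs_distC; exact: ltW (yx i).
Qed.

(** A polynomial p with p(z) outside p(L) still separates after small changes of z and L. The
    tolerances found near each x in L are made uniform by compactness, the parameter being the pair
    (z', e). *)
Lemma poly_hull_sep (R : realType) (n : nat) (L : set (Cn R n)) z :
  compact L -> ~ poly_hull L z ->
  \forall z' \near z & e \near 0^'+,
    forall L', L' `<=` thickening e L -> ~ poly_hull L' z'.
Proof.
move=> /compact_near_coveringP cL /existsNP [p pz].
have : \forall u \near filter_prod (nbhs z) (0 : R)^'+,
    L `<=` [set x | forall y, ball x u.2%:C y -> peval p y <> peval p u.1].
  apply: cL => x Lx.
  (* Half the gap: one half for moving x to y, the other for moving z to z'. *)
  have d0 : 0 < cabs (peval p x - peval p z) / 2.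
    rewrite divr_gt0 // lt_neqAle cabs_ge0 andbT eq_sym; apply/eqP => /cabs_eq0/eqP.
    by rewrite subr_eq0 => /eqP pxz; apply: pz; exists x.
  set d := cabs _ / 2 in d0.
  have /nbhs_ballC [e e0 xe] := continuous_cabs d0 (@peval_continuous R n p x).
  have nz := continuous_cabs d0 (@peval_continuous R n p z).
  have e20 : 0 < e / 2 by rewrite divr_gt0.
  (* Radius e / 2 around x plus a thickening below e / 2 keeps y within e of x. *)
  exists (ball x (e / 2)%:C,
     [set z' | cabs (peval p z - peval p z') < d] `*` [set r | r < e / 2]).
    split=> /=; first by apply/nbhs_ballC; exists (e / 2).
    exists ([set z' | cabs (peval p z - peval p z') < d], [set r | r < e / 2]) => //.
    by split=> //=; exact: nbhs_right_lt.
  move=> [x' [z' r]] /= [xx' [zz' re]] y x'y pyz.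
  have : ball x e%:C y.
    rewrite (splitr e) rmorphD /=; apply: ball_triangle xx' _.
    by apply: le_ball x'y; rewrite lecR ltW.
  move=> /xe /=; rewrite pyz => xz'.
  have : cabs (peval p x - peval p z) < d + d.
    apply: le_lt_trans (cabs_distD (peval p z') _ _) _; apply: ltrD xz' _.
    rewrite cabs_distC; exact: zz'.
  by rewrite -splitr ltxx.
apply: filterS => -[z' e] /= H L' LL' /(_ p) [x /LL' [y Ly yx] pxz].
exact: (H y Ly x yx pxz).
Qed.

(** Both the openness of the complement and the enclosing box are the case L' = L of the preceding
    lemmas. *)
Lemma poly_hull_compact (R : realType) (n : nat) (L : set (Cn R n)) :
  compact L -> compact (poly_hull L).
Proof.
move=> cL; have [M LM] := compact_coord_bounded cL.
apply: (subclosed_compact _ (@polybox_compact R n (M + 1))); last first.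
  exact: poly_hull_polybox LM (sub_thickening ltr01).
rewrite -[poly_hull L]setCK; apply: open_closedC; rewrite openE => z /= nz.
have [[A B] /= [Az B0] AB] := poly_hull_sep cL nz.
apply: filterS Az => z' Az'.
have [e e0 Be] := near_right_ex B0.
exact: (AB (z', e) (conj Az' Be) L (sub_thickening e0)).
Qed.

(** Separation holds locally at each point of G in the enclosing box, and compactness of that part
    of G yields a common e. Taking e <= 1 keeps the perturbed hulls in the box. *)
Lemma poly_hull_usc (R : realType) (n : nat) (L G : set (Cn R n)) :
  compact L -> closed G -> poly_hull L `&` G = set0 ->
  exists2 e : R, 0 < e & forall L', L' `<=` thickening e L ->
    poly_hull L' `&` G = set0.
Proof.
move=> cL cG LG; have [M LM] := compact_coord_bounded cL.
have /compact_near_coveringP cC : compact (polybox (M + 1) `&` G).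
  by apply: compact_closedI => //; exact: polybox_compact.
have H : \forall e \near (0 : R)^'+, polybox (M + 1) `&` G `<=`
    [set z | forall L', L' `<=` thickening e L -> ~ poly_hull L' z].
  apply: cC => z [_ Gz]; apply: poly_hull_sep => // hz.
  by have : (poly_hull L `&` G) z by []; rewrite LG.
have [e e0 [e1 {}H]] := near_right_ex (filterI (nbhs_right_le (@ltr01 R)) H).
exists e => // L' LL'; apply/seteqP; split=> // z [hz Gz].
apply: (H z _ L' LL' hz); split=> //.
apply: (poly_hull_polybox LM _ hz) => x /LL' [y Ly yx].
by exists y => //; apply: le_ball yx; rewrite lecR.
Qed.

Lemma rational_hull_ncompact (R : realType) (n : nat) (L : ncompact R n) :
  rational_hull (sval L) !=set0 /\ compact (rational_hull (sval L)).
Proof.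
case: L => L [[x Lx] cL] /=; rewrite rational_hullE //.
by split; [exists x; exact: sub_poly_hull|exact: poly_hull_compact].
Qed.

Definition hull (R : realType) (n : nat) (L : ncompact R n) : ncompact R n :=
  exist _ (rational_hull (sval L)) (rational_hull_ncompact L).

Lemma sval_hull (R : realType) (n : nat) (L : ncompact R n) :
  sval (hull L) = poly_hull (sval L).
Proof. by rewrite /= rational_hullE //; case: (svalP L). Qed.

(** * Estimates for the Hausdorff distance *)

Lemma pt_set_dist_le (R : realType) (n : nat) (z b : Cn R n) (B : set (Cn R n)) :
  B b -> pt_set_dist z B <= cdist z b.
Proof.
move=> Bb; apply: ge_inf; last by exists b.
by exists 0 => _ [y _ <-]; exact: cdist_ge0.
Qed.

Lemma hausdorff_thickening (R : realType) (n : nat) (A B : ncompact R n) (e : R) :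
  0 < e -> hausdorff_dist (sval A) (sval B) < e -> sval B `<=` thickening e (sval A).
Proof.
case: A B => [A [[a Aa] cA]] [B [_ cB]] /= e0 ABe x Bx.
have [M BM] := compact_coord_bounded cB.
have [N aN] := compact_coord_bounded (@compact_set1 _ a).
(* The [sup] in the Hausdorff distance dominates its terms only once they are bounded; distances to
   the fixed point a of A give a bound. *)
have ub : has_ubound [set pt_set_dist b A | b in B].
  have c0 : 0 < `|M| + `|N| + 1 by rewrite ltr_wpDl ?addr_ge0.
  exists (Num.sqrt n%:R * (`|M| + `|N| + 1)) => _ [b Bb <-].
  apply: le_trans (pt_set_dist_le b Aa) _; apply: ball_cdist c0 _.
  apply/ball_coordP => // i.
  apply: le_lt_trans (cabs_distD 0 _ _) _; rewrite subr0 (cabs_distC 0) subr0.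
  apply: ltr_pwDr ltr01 _; apply: lerD.
    by apply: le_trans (BM b Bb i) _; exact: ler_norm.
  by apply: le_trans (aN a erefl i) _; exact: ler_norm.
have : pt_set_dist x A < e.
  apply: le_lt_trans ABe; rewrite /hausdorff_dist le_max; apply/orP; right.
  by apply: ub_le_sup => //; exists x.
move=> /inf_lt [|_ [y Ay <-] xy]; first by exists (cdist x a); exists a.
by exists y => //; apply: ball_sym; exact: cdist_ball xy.
Qed.

Lemma hausdorff_dist_le (R : realType) (n : nat) (A B : ncompact R n) (c : R) :
  (forall a, sval A a -> exists2 b, sval B b & cdist a b <= c) ->
  (forall b, sval B b -> exists2 a, sval A a & cdist b a <= c) ->
  hausdorff_dist (sval A) (sval B) <= c.
Proof.
case: A B => [A [[a Aa] _]] [B [[b Bb] _]] /= AB BA.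
rewrite /hausdorff_dist ge_max; apply/andP; split; apply: ge_sup.
- by exists (pt_set_dist a B); exists a.
- by move=> _ [x /AB [y By xy] <-]; apply: le_trans xy; exact: pt_set_dist_le.
- by exists (pt_set_dist b A); exists b.
- by move=> _ [x /BA [y By xy] <-]; apply: le_trans xy; exact: pt_set_dist_le.
Qed.

(** * A countable family generating the Hausdorff open sets by unions *)

Definition rat_point (R : realType) (n : nat) (u : 'rV[rat * rat]_n) : Cn R n :=
  \row_i (ratr (u ord0 i).1 +i* ratr (u ord0 i).2).

Lemma rat_near (R : realType) (x e : R) : 0 < e -> exists q : rat, `|ratr q - x| < e.
Proof.
move=> e0; have [|q] := @rat_in_itvoo R (x - e) (x + e); first by lra.
by rewrite in_itv /= => /andP [? ?]; exists q; rewrite ltr_distl;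
  apply/andP; split; lra.
Qed.

Lemma rat_point_dense (R : realType) (n : nat) (z : Cn R n) (e : R) : 0 < e ->
  exists u, ball (rat_point R u) e%:C z.
Proof.
move=> e0; have e20 : 0 < e / 2 by rewrite divr_gt0.
have /choice [u uz] : forall i, exists q : rat * rat,
    `|ratr q.1 - complex.Re (z ord0 i)| < e / 2 /\
    `|ratr q.2 - complex.Im (z ord0 i)| < e / 2.
  move=> i; have [a az] := rat_near (complex.Re (z ord0 i)) e20.
  by have [b bz] := rat_near (complex.Im (z ord0 i)) e20; exists (a, b).
exists (\row_i u i); apply/ball_coordP => // i; rewrite !mxE.
by have := uz i; case: (z ord0 i) => a b [ua ub]; exact: cabs_lt_half.
Qed.

Definition net_nbhd (R : realType) (n : nat) (F : seq 'rV[rat * rat]_n) (k : nat) :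
    set (ncompact R n) :=
  [set L |
     sval L `<=` \bigcup_(u in [set` F]) ball (rat_point R u) (k.+1%:R^-1)%:C /\
     forall u, u \in F -> sval L `&` ball (rat_point R u) (k.+1%:R^-1)%:C !=set0].

Lemma net_nbhd_cover (R : realType) (n : nat) (L : ncompact R n) (k : nat) :
  exists F, net_nbhd F k L.
Proof.
have [_ cL] := svalP L; set r : R := k.+1%:R^-1.
have r0 : 0 < r by rewrite invr_gt0.
(* Only centres whose ball meets L are allowed, so any finite subcover satisfies the second clause
   of [net_nbhd]. *)
pose D := [set u | sval L `&` ball (rat_point R u) r%:C !=set0].
have := cL; rewrite [X in X _ -> _]compact_cover.
move=> /(_ _ D (fun u => ball (rat_point R u) r%:C)).
case=> [u _||F FD LF]; first exact: ball_open.
  by move=> z Lz; have [u uz] := rat_point_dense z r0; exists u => //; exists z.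
by exists (finmap.enum_fset F); split=> //= u /FD; rewrite inE.
Qed.

(** A point of either set shares a ball of the net with some point of the other; the triangle
    inequality through the centre gives twice the radius. *)
Lemma net_nbhd_close (R : realType) (n : nat) (F : seq 'rV[rat * rat]_n) (k : nat)
    (A B : ncompact R n) :
  net_nbhd F k A -> net_nbhd F k B ->
  hausdorff_dist (sval A) (sval B) <= Num.sqrt n%:R * (k.+1%:R^-1 + k.+1%:R^-1).
Proof.
set r : R := k.+1%:R^-1; have r0 : 0 < r by rewrite invr_gt0.
have rr0 : 0 < r + r by rewrite addr_gt0.
have aux (A' B' : ncompact R n) : net_nbhd F k A' -> net_nbhd F k B' ->
    forall a, sval A' a ->
    exists2 b, sval B' b & cdist a b <= Num.sqrt n%:R * (r + r).
  move=> [AF _] [_ FB] a /AF [u /FB [b [Bb ub]] ua].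
  exists b => //; apply: ball_cdist rr0 _; rewrite rmorphD /=.
  by apply: ball_triangle ub; exact: ball_sym.
by move=> AF BF; apply: hausdorff_dist_le; exact: aux.
Qed.

Lemma hausdorff_open_bigcup (R : realType) (n : nat) (U : set (ncompact R n)) :
  hausdorff_open U ->
  U = \bigcup_(Fk in [set Fk : seq 'rV[rat * rat]_n * nat |
         net_nbhd Fk.1 Fk.2 `<=` U]) net_nbhd Fk.1 Fk.2.
Proof.
move=> oU; apply/seteqP; split=> [L UL|L [Fk FkU]]; last exact: FkU.
have [e e0 LeU] := oU L UL.
pose s : R := Num.sqrt n%:R.
have s0 : 0 <= s by exact: sqrtr_ge0.
(* The diameter bound 2 sqrt n / (k + 1) must fall below e; the extra 1 keeps the divisor positive
   when n = 0. *)
have [|k] := @ltr_add_invr R 0 (e / (s + s + 1)).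
  by rewrite divr_gt0 // ltr_wpDl ?addr_ge0.
rewrite add0r ltr_pdivlMr ?ltr_wpDl ?addr_ge0 // => ke.
have [F LF] := net_nbhd_cover L k.
exists (F, k) => //= A AF; apply: LeU; apply: le_lt_trans (net_nbhd_close LF AF) _.
apply: le_lt_trans ke; rewrite -/s.
have k0 : 0 <= k.+1%:R^-1 :> R by rewrite invr_ge0.
by rewrite !mulrDr mulr1 !(mulrC s) lerDl.
Qed.

Lemma open_closed_bigcup (R : realType) (V : pseudoMetricType R[i]) (O : set V) :
  open O -> exists2 G : (set V)^nat, (forall k, closed (G k)) & O = \bigcup_k G k.
Proof.
move=> oO.
(* The complement of [N k] holds the points staying about 1 / (k + 1) away from the complement of O.
   Interiors are taken since balls of a general pseudometric space need not be open. *)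
pose N k := \bigcup_(w in ~` O) (ball w (k.+1%:R^-1 : R)%:C)°.
exists (fun k => ~` N k).
  by move=> k; apply: open_closedC; apply: bigcup_open => w _; exact: open_interior.
apply/seteqP; split=> [z Oz|z [k _ Nz]].
  have /nbhs_ballC [e e0 zO] := open_nbhs_nbhs (conj oO Oz).
  have [k] := ltr_add_invr e0; rewrite add0r => ke.
  exists k => // -[w Ow /interior_subset wz]; apply: Ow; apply: zO.
  by apply: ball_sym; apply: le_ball wz; rewrite lecR ltW.
apply: contrapT => Oz; apply: Nz; exists z => //.
by apply/nbhs_ballC; exists k.+1%:R^-1; rewrite // invr_gt0.
Qed.

(** * Measurability of the hull *)

Section measurability.
Variables (R : realType) (n : nat) (d : measure_display).
Variables (Omega : measurableType d) (K : Omega -> ncompact R n).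
Hypothesis mK : random_compact_set K.

Lemma measurable_hull_miss (G : set (Cn R n)) : closed G ->
  measurable [set w | poly_hull (sval (K w)) `&` G = set0].
Proof.
move=> cG; apply: (mK (B := [set L | poly_hull (sval L) `&` G = set0])).
(* By semicontinuity this set of L is Hausdorff open, hence a generator of the Borel sets. *)
apply: sub_gen_smallest => L /= LG; have [_ cL] := svalP L.
have [e e0 eG] := poly_hull_usc cL cG LG.
by exists e => // L' LL'; apply: eG; exact: hausdorff_thickening.
Qed.

(** Upper semicontinuity does not make this condition open in L; exhausting O by closed sets reduces
    it to countably many complements of misses. *)
Lemma measurable_hull_hit (O : set (Cn R n)) : open O ->
  measurable [set w | poly_hull (sval (K w)) `&` O !=set0].
Proof.
move=> /open_closed_bigcup [G cG ->].
have -> : [set w | poly_hull (sval (K w)) `&` \bigcup_k G k !=set0] =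
    \bigcup_k ~` [set w | poly_hull (sval (K w)) `&` G k = set0].
  apply/seteqP; split=> w /=.
    move=> [z [hz [k _ Gz]]]; exists k => //= e.
    by have : (poly_hull (sval (K w)) `&` G k) z by []; rewrite e.
  by move=> [k _ /= /eqP/set0P [z [hz Gz]]]; exists z; split=> //; exists k.
by apply: bigcupT_measurable => k; apply: measurableC; exact: measurable_hull_miss.
Qed.

Lemma measurable_hull_net (F : seq 'rV[rat * rat]_n) (k : nat) :
  measurable [set w | net_nbhd F k (hull (K w))].
Proof.
pose B (u : 'rV[rat * rat]_n) : set (Cn R n) := ball (rat_point R u) (k.+1%:R^-1)%:C.
(* Being covered by the balls is missing a closed set; meeting each ball is a finite list of
   hits. *)
have -> : [set w | net_nbhd F k (hull (K w))] =
    [set w | poly_hull (sval (K w)) `&` ~` (\bigcup_(u in [set` F]) B u) = set0] `&`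
    \bigcap_(u in [set` F]) [set w | poly_hull (sval (K w)) `&` B u !=set0].
  apply/seteqP; split=> w; rewrite /net_nbhd /setI /mkset sval_hull.
    by move=> [/subsets_disjoint].
  by move=> [/subsets_disjoint].
have oB u : open (B u) by exact: ball_open.
apply: measurableI.
  by apply: measurable_hull_miss; apply: open_closedC; exact: bigcup_open.
apply: fin_bigcap_measurable; first exact: finite_seq.
by move=> u _; exact: measurable_hull_hit.
Qed.

Lemma random_hull : random_compact_set (fun w => hull (K w)).
Proof.
(* The sets with measurable preimage form a sigma-algebra, so only Hausdorff open sets have to be
   checked. *)
pose S := [set B : set (ncompact R n) | measurable ((fun w => hull (K w)) @^-1` B)].
rewrite /random_compact_set; change (@hausdorff_borel R n `<=` S).
apply: smallest_sub => [|U oU].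
  split; first by rewrite /S /= preimage_set0; exact: measurable0.
    by move=> B SB; rewrite /S /= setTD preimage_setC; exact: measurableC.
  by move=> B SB; rewrite /S /= preimage_bigcup; exact: bigcupT_measurable.
(* The union is extended to the whole countable type of pairs (F, k), with empty terms for nets not
   inside U. *)
rewrite /S /= (hausdorff_open_bigcup oU) bigcup_mkcond preimage_bigcup.
apply: countable_bigcupT_measurable => [|[F k]]; first exact: countableP.
by case: ifPn => _; [exact: measurable_hull_net|rewrite preimage_set0].
Qed.

End measurability.

Theorem theorem6p19 (R : realType) (n : nat) (d : measure_display)
    (Omega : measurableType d) (K : Omega -> ncompact R n) :
  random_compact_set K ->
  exists H : Omega -> ncompact R n,
    (forall w, sval (H w) = rational_hull (sval (K w))) /\ random_compact_set H.
Proof.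
by move=> mK; exists (fun w => hull (K w)); split=> //; exact: random_hull.
Qed.
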